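(* Let $0\le d\le k$. Then $$\mathfrak M_{[2k+1,2d+1]}(x)=1+xR_k(x^2).$$
   Context: $\mathfrak S_n$ is the set of permutations of $\{1,\dots,n\}$ (for $n=0$, the empty permutation, which is even). A permutation avoids a pattern $\tau$ of length $\ell$ if none of its length-$\ell$ subsequences is order-isomorphic to $\tau$. For $1\le d\le k$, $[k,d]$ denotes the pattern $(d+1)(d+2)\ldots k\,1\,2\ldots d\in\mathfrak S_k$ (so $[k,k]=12\ldots k$). $\mathfrak M_\tau(x)=\mathfrak E_\tau(x)-\mathfrak O_\tau(x)$, where $\mathfrak E_\tau(x)$ (resp. $\mathfrak O_\tau(x)$) is the ordinary generating function in $n$ for the number of even (resp. odd) permutations in $\mathfrak S_n$, $n\ge0$, avoiding both $132$ and $\tau$. $U_r$ is the Chebyshev polynomial of the second kind: $U_0(t)=1$, $U_1(t)=2t$, $U_r(t)=2tU_{r-1}(t)-U_{r-2}(t)$. For $k\ge1$, $R_k(x)=\dfrac{U_{k-1}\left(\frac1{2\sqrt x}\right)}{\sqrt x\,U_k\left(\frac1{2\sqrt x}\right)}$, a rational function of $x$, and $R_0(x)=0$; equivalently $R_k(x)=1/(1-xR_{k-1}(x))$ for $k\ge1$. *)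

(* Defs.v *)
From mathcomp Require Import all_boot all_order perm all_algebra.
From mathcomp Require Import generic_quotient.
Set Implicit Arguments.
Unset Strict Implicit.
Unset Printing Implicit Defensive.
Import GRing.Theory.
Local Open Scope ring_scope.
Local Open Scope quotient_scope.

(* Patterns are written in one-line notation, as sequences of naturals. The
   elements of {1, ..., n} are represented by 'I_n, i.e. shifted by one, which
   affects neither order isomorphism nor signs. *)

(* f selects the positions of an occurrence of the pattern tau in s. *)
Definition contains n (s : 'S_n) (tau : seq nat) : bool :=
  [exists f : {ffun 'I_(size tau) -> 'I_n},
    [forall i : 'I_(size tau), forall j : 'I_(size tau),
       (i < j)%N ==> (f i < f j)%N] &&
    [forall i : 'I_(size tau), forall j : 'I_(size tau),
       (nth 0 tau i < nth 0 tau j)%N == (s (f i) < s (f j))%N]].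

Definition avoids n (s : 'S_n) (tau : seq nat) : bool := ~~ contains s tau.

Definition pat132 : seq nat := [:: 1; 3; 2]%N.

(* [k, d] = (d+1) (d+2) ... k 1 2 ... d *)
Definition pat (k d : nat) : seq nat := iota d.+1 (k - d) ++ iota 1 d.

(* A formal power series is represented by its sequence of coefficients. *)
Definition E_ (tau : seq nat) : nat -> rat := fun n =>
  #|[set s : 'S_n | [&& ~~ odd_perm s, avoids s pat132 & avoids s tau]]|%:R.

Definition O_ (tau : seq nat) : nat -> rat := fun n =>
  #|[set s : 'S_n | [&& odd_perm s, avoids s pat132 & avoids s tau]]|%:R.

Definition M_ (tau : seq nat) : nat -> rat := fun n => E_ tau n - O_ tau n.

Fixpoint chebU (A : comNzRingType) (r : nat) (t : A) : A :=
  match r with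
  | 0 => 1
  | r1.+1 => match r1 with
             | 0 => 2%:R * t
             | r2.+1 => 2%:R * t * chebU r1 t - chebU r2 t
             end
  end.

Notation ratfun := {fraction {poly rat}}.
Notation "p %:F" := (@tofrac _ p) : ring_scope.

Definition ratX : ratfun := 'X%:F.

(* F(g(x)); meaningful for nonconstant g, for which p \Po g = 0 only if p = 0
   (see ratfun_compE). *)
Definition ratfun_comp (F : ratfun) (g : {poly rat}) : ratfun :=
  (\n_(repr F) \Po g)%:F / (\d_(repr F) \Po g)%:F.

(* f = F in the fraction field of the formal power series: q f = p for some
   fraction p / q representing F. *)
Definition is_expansion (f : nat -> rat) (F : ratfun) : Prop :=
  exists p q : {poly rat},
    [/\ q != 0, F = p%:F / q%:F &
        forall n : nat, \sum_(i < n.+1) q`_i * f (n - i)%N = p`_n].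

Lemma ratfun_numden (F : ratfun) :
  F = (\n_(repr F))%:F / (\d_(repr F))%:F.
Proof.
have dF : \d_(repr F) != 0 by apply: denom_ratioP.
apply: (canRL (mulfK _)); first by rewrite tofrac_eq0.
unlock tofrac; rewrite -{1}(reprK F) -[LHS]FracField.pi_mul.
apply/eqmodP; rewrite /= FracField.equivfE /FracField.mulf.
by rewrite !numden_Ratio ?mulr1 ?oner_neq0 // mulrC.
Qed.

Lemma ratfun_compE (p q g : {poly rat}) : q != 0 -> (1 < size g)%N ->
  ratfun_comp (p%:F / q%:F) g = (p \Po g)%:F / (q \Po g)%:F.
Proof.
move=> q0 g1; rewrite /ratfun_comp.
have cn0 (h : {poly rat}) : h != 0 -> h \Po g != 0.
  by move=> h0; rewrite comp_poly_eq0.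
set F := p%:F / q%:F.
have dF : \d_(repr F) != 0 by apply: denom_ratioP.
have: (\n_(repr F) * q)%:F = (p * \d_(repr F))%:F :> ratfun.
  rewrite !tofracM; apply/eqP; rewrite -eqr_div ?tofrac_eq0 //; apply/eqP.
  by rewrite -ratfun_numden.
move/eqP; rewrite tofrac_eq => /eqP e.
apply/eqP; rewrite eqr_div ?tofrac_eq0 ?cn0 // -!tofracM tofrac_eq.
by rewrite -!comp_polyM e.
Qed.

Lemma ratfun_comp_inj (g : {poly rat}) : (1 < size g)%N ->
  injective (fun F => ratfun_comp F g).
Proof.
move=> g1 F G; rewrite /ratfun_comp.
have cn0 (h : {poly rat}) : h != 0 -> h \Po g != 0.
  by move=> h0; rewrite comp_poly_eq0.
have dn0 (H : ratfun) : \d_(repr H) != 0 by apply: denom_ratioP.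
move/eqP; rewrite eqr_div ?tofrac_eq0 ?cn0 // -!tofracM tofrac_eq.
rewrite -!comp_polyM -subr_eq0 -comp_polyB => /eqP/eqP.
rewrite comp_poly_eq0 // subr_eq0 => e.
apply/eqP; rewrite (ratfun_numden F) (ratfun_numden G).
by rewrite eqr_div ?tofrac_eq0 // -!tofracM tofrac_eq.
Qed.

(* chebV r (t^2) = t^r U_r (1 / (2 t)) *)
Fixpoint chebV (r : nat) : {poly rat} :=
  match r with
  | 0 => 1
  | r1.+1 => match r1 with
             | 0 => 1
             | r2.+1 => chebV r1 - 'X * chebV r2
             end
  end.

Lemma chebV_coef0 r : (chebV r)`_0 = 1.
Proof.
suff: (chebV r)`_0 = 1 /\ (chebV r.+1)`_0 = 1 by case.
elim: r => [|r [h0 h1]]; first by rewrite /= coef1.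
by split=> //; rewrite [chebV _]/= -/(chebV r.+1) coefB coefXM h1 subr0.
Qed.

Lemma chebV_neq0 r : chebV r != 0.
Proof.
apply/eqP => /(congr1 (fun p : {poly rat} => p`_0)).
by rewrite chebV_coef0 coef0 => /eqP; rewrite oner_eq0.
Qed.

Lemma ratX_neq0 : ratX != 0.
Proof. by rewrite tofrac_eq0 polyX_eq0. Qed.

Lemma chebUV r :
  (chebV r \Po 'X^2)%:F = ratX ^+ r * chebU r (2%:R * ratX)^-1.
Proof.
have two0 : (2%:R : ratfun) != 0.
  by rewrite -(rmorph_nat (@tofrac {poly rat})) tofrac_eq0 -polyC_natr polyC_eq0.
have h1 : 2%:R * (2%:R * ratX)^-1 = ratX^-1.
  by rewrite invfM mulrA divff ?mul1r.
suff: (chebV r \Po 'X^2)%:F = ratX ^+ r * chebU r (2%:R * ratX)^-1 /\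
  (chebV r.+1 \Po 'X^2)%:F = ratX ^+ r.+1 * chebU r.+1 (2%:R * ratX)^-1.
  by case.
elim: r => [|r [e0 e1]].
  rewrite /= comp_polyC tofrac1 expr0 mul1r expr1 h1.
  by rewrite divff ?ratX_neq0.
split=> //; rewrite [chebV _]/= -/(chebV r.+1) [chebU _ _]/=.
rewrite -/(chebU r.+1 (2%:R * ratX)^-1) h1.
rewrite comp_polyB comp_polyM comp_polyX tofracB tofracM e0 e1.
rewrite tofracXn -/ratX mulrBr; congr (_ - _).
  rewrite [in RHS]exprS [ratX ^+ r.+1 * _]mulrC mulrACA divff ?ratX_neq0 //.
  by rewrite mul1r mulrC.
by rewrite mulrA -exprD.
Qed.

(* U_(k-1) (1 / (2 t)) / (t U_k (1 / (2 t))) in rat(t), for k >= 1 *)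
Definition chebR (k : nat) : ratfun :=
  chebU k.-1 (2%:R * ratX)^-1 / (ratX * chebU k (2%:R * ratX)^-1).

Lemma chebRE k :
  ratfun_comp ((chebV k)%:F / (chebV k.+1)%:F) 'X^2 = chebR k.+1.
Proof.
rewrite ratfun_compE ?chebV_neq0 ?size_polyXn // !chebUV exprSr -mulrA.
by rewrite -mulf_div divff ?mul1r // expf_neq0 ?ratX_neq0.
Qed.

Lemma Rk_exists k : exists F : ratfun, ratfun_comp F 'X^2 == chebR k.+1.
Proof. by eexists; apply/eqP/chebRE. Qed.

(* For k >= 1, R_k(x) involves t = sqrt x: it is the rational function F such
   that F(t^2) = chebR k; F is unique by ratfun_comp_inj. *)
Definition Rk (k : nat) : ratfun :=
  if k is k'.+1 then xchoose (Rk_exists k') else 0.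

Lemma Rk_spec k : ratfun_comp (Rk k.+1) 'X^2 = chebR k.+1.
Proof. exact/eqP/(xchooseP (Rk_exists k)). Qed.

Lemma Rk_rec k : Rk k.+1 = 1 / (1 - ratX * Rk k).
Proof.
have RE j : Rk j.+1 = (chebV j)%:F / (chebV j.+1)%:F.
  by apply: (@ratfun_comp_inj 'X^2); rewrite ?size_polyXn // Rk_spec chebRE.
rewrite RE; case: k => [|k]; first by rewrite /= mulr0 subr0 tofrac1.
have V0 : (chebV k.+1)%:F != 0 :> ratfun by rewrite tofrac_eq0 chebV_neq0.
rewrite RE [chebV k.+2]/= -/(chebV k.+1) tofracB tofracM -/ratX.
set V := (chebV k.+1)%:F in V0 *.
by rewrite mul1r mulrA -[1 in RHS](divff V0) -mulrBl invf_div.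
Qed.

(* Main.v *)
Require Import Defs.
From mathcomp Require Import all_boot all_order perm all_algebra.
From mathcomp Require Import zify ring.
Set Implicit Arguments.
Unset Strict Implicit.
Unset Printing Implicit Defensive.
Import GRing.Theory.
Local Open Scope ring_scope.

(** Write a nonempty permutation avoiding 132 as u n v, where n is the largest
    value.  Then every entry of u exceeds every entry of v, and u and v are
    arbitrary 132-avoiding words of sizes a and b.  The inversions are those of
    u, those of v, the b pairs formed with n, and the a b pairs across, so the
    sign of u n v is (-1)^((a + 1) b) sgn u sgn v (lemma [sgn_top]).

    The pattern [k, d] consists of an increasing run of k - d values above an
    increasing run of d values ([skew (k - d) d] below).  When both runs are
    nonempty, it occurs in u n v exactly when it occurs in u, or in v, or with
    its upper run in u n and its lower run in v ([skew_top]).  A single increasing run of length l + 1 occurs when a run of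
    length l occurs in u or one of length l + 1 occurs in v ([inc_top]).
    Hence the signed counts I_l (avoiding 12...l) and F (avoiding the pattern
    with runs p + 1 and q) satisfy, with the twisted convolution
      (f * g)(n) = sum over a + b = n of (-1)^((a + 1) b) f(a) g(b),
    the recurrences
      I_(l+1)(n + 1) = (I_l * I_(l+1))(n),
      F(n + 1) = (I_p * F + F * I_q - I_p * I_q)(n).

    The twist depends on parities only, so that splitting each series into its
    even and odd parts turns the recurrences into ordinary identities between
    power series.  If I_(2j+1) has even part 1 and odd part x R_j, with R_j
    short for R_j(x^2), then the even and odd parts E, O of I_(2j+2) satisfy
    O = x R_(j+1) E and E = R_(j+1) (1 - x O); this makes 1 the even part and
    x R_(j+1) the odd part of I_(2j+3) ([inc_odd_step]).  So
    I_(2j+1) = 1 + x R_j for all j.  Substituting I_(2a+1) and I_(2d+1) in the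
    recurrence of F, with p = 2a + 1, q = 2d + 1 and k = a + d + 1, gives the
    even part 1, and an odd part x R where
      R (1 - x^2 (R_a + R_d)) = 1 - x^2 R_a R_d.
    The addition formula for the Chebyshev denominators ([den_add]) says that
    R_(a+d+1) is the solution; it does not depend on how k - 1 is split.

    Power series are handled through their truncations, polynomials modulo
    X^N for every N.  An identity modulo X^N is derived from others by
    exhibiting the linear combination that yields it, and a factor with nonzero
    constant term may be cancelled ([dvdXn_cancel]). *)

(** * Occurrences of skew patterns in words *)

Section Words.
Local Open Scope nat_scope.

(** The predicate Q stands for a pattern: it recognizes the words that are
    order isomorphic to it. *)
Definition occurs (Q : pred (seq nat)) (w : seq nat) : bool :=
  [exists m : (size w).-tuple bool, Q (mask m w)].

Lemma occursP (Q : pred (seq nat)) (w : seq nat) :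
  reflect (exists2 t, subseq t w & Q t) (occurs Q w).
Proof.
apply: (iffP existsP) => [[m Qm]|[t /subseqP[m sm ->] Qt]].
  by exists (mask m w); first exact: mask_subseq.
by exists (tcast sm (in_tuple m)); rewrite val_tcast.
Qed.

Lemma occurs_sub (Q : pred (seq nat)) (u w : seq nat) :
  subseq u w -> occurs Q u -> occurs Q w.
Proof.
move=> uw /occursP[t tu Qt]; apply/occursP; exists t => //.
exact: subseq_trans tu uw.
Qed.

Lemma subseq_catP (t u v : seq nat) : subseq t (u ++ v) ->
  exists t1 t2, [/\ t = t1 ++ t2, subseq t1 u & subseq t2 v].
Proof.
case/subseqP => m sm ->; exists (mask (take (size u) m) u).
exists (mask (drop (size u) m) v); split; rewrite ?mask_subseq //.
rewrite -{1}(cat_take_drop (size u) m) mask_cat // size_takel //.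
by rewrite sm size_cat leq_addr.
Qed.

(** The words order isomorphic to [p + q, q]; for p = 0 these are the increasing
    words of length q. *)
Definition skew (p q : nat) (t : seq nat) : bool :=
  [&& size t == p + q, pairwise ltn (take p t), pairwise ltn (drop p t)
    & allrel gtn (take p t) (drop p t)].

Definition is132 (t : seq nat) : bool :=
  if t is [:: x; z; y] then x < y < z else false.

Lemma skew_cat (p q : nat) (t1 t2 : seq nat) : size t1 = p ->
  skew p q (t1 ++ t2) =
    [&& size t2 == q, pairwise ltn t1, pairwise ltn t2 & allrel gtn t1 t2].
Proof.
by move=> <-; rewrite /skew take_size_cat // drop_size_cat // size_cat eqn_add2l.
Qed.

Lemma occurs_skewP p q (w : seq nat) : reflect
  (exists t1 t2, [/\ subseq (t1 ++ t2) w, size t1 = p, size t2 = q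
     & [/\ pairwise ltn t1, pairwise ltn t2 & allrel gtn t1 t2]])
  (occurs (skew p q) w).
Proof.
apply: (iffP (occursP _ _)) => [[t tw /and4P[/eqP st h1 h2 h3]]|].
  exists (take p t), (drop p t); rewrite cat_take_drop; split=> //.
    by rewrite size_takel // st leq_addr.
  by rewrite size_drop st addKn.
case=> t1 [t2 [tw s1 s2 [h1 h2 h3]]]; exists (t1 ++ t2) => //.
by rewrite skew_cat // s2 eqxx h1 h2.
Qed.

Lemma occurs_incP l (w : seq nat) : reflect
  (exists t, [/\ subseq t w, size t = l & pairwise ltn t])
  (occurs (skew 0 l) w).
Proof.
apply: (iffP (occurs_skewP _ _ _)) => [[t1 [t2 [tw /size0nil t10 s2 [_ h _]]]]|].
  by exists t2; split => //; move: tw; rewrite t10.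
by case=> t [tw st h]; exists [::], t; split.
Qed.

Lemma occurs_inc0 w : occurs (skew 0 0) w.
Proof. by apply/occurs_incP; exists [::]; rewrite sub0seq. Qed.

Lemma occurs_inc_le l (t w : seq nat) :
  l <= size t -> subseq t w -> pairwise ltn t ->
  occurs (skew 0 l) w.
Proof.
move=> lt tw h; apply/occurs_incP; exists (take l t); split.
- by apply: subseq_trans tw; apply: take_subseq.
- by rewrite size_takel.
- by apply: subseq_pairwise h; apply: take_subseq.
Qed.

(** At most the last entry of an increasing subsequence of u n is outside u. *)
Lemma subseq_rcons_trunc l n (t u : seq nat) :
  size t = l.+1 -> subseq t (rcons u n) -> pairwise ltn t -> occurs (skew 0 l) u.
Proof.
move=> st; rewrite -cats1 => /subseq_catP[c [d [tE cu dn]]] h.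
have sd : size d <= 1 := size_subseq dn.
apply: (@occurs_inc_le l c) => //; last first.
  by move: h; rewrite tE pairwise_cat => /and3P[].
by rewrite -ltnS -st tE size_cat -addn1 leq_add2l.
Qed.

Lemma subseq_rcons_last (t : seq nat) z (u : seq nat) n : z != n ->
  subseq (rcons t z) (rcons u n) -> subseq (rcons t z) u.
Proof.
by move=> /negPf zn; rewrite -subseq_rev !rev_rcons /= zn -rev_rcons subseq_rev.
Qed.

Section Top.
Variables (u v : seq nat) (n : nat).
Hypotheses (un : all (gtn n) u) (vn : all (gtn n) v) (uv : allrel gtn u v).

Let w := u ++ n :: v.

Let uw : subseq u w. Proof. exact: prefix_subseq. Qed.
Let vw : subseq v w.
Proof. by rewrite /w -cat_rcons; exact: suffix_subseq. Qed.

(** Entries up to and including n dominate the entries after n. *)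
Let no_ascent (a b : seq nat) :
  subseq a (rcons u n) -> subseq b v -> allrel ltn a b -> a = [::] \/ b = [::].
Proof.
case: a => [|x a]; first by left.
case: b => [|y b] au bv; first by right.
move=> /allrelP/(_ x y); rewrite !inE !eqxx => /(_ isT isT) /= xy.
have yv : y \in v by apply: (mem_subseq bv); rewrite inE eqxx.
have: x \in rcons u n by apply: (mem_subseq au); rewrite inE eqxx.
rewrite mem_rcons inE => /predU1P[xn|xu].
  by have /= := allP vn _ yv; lia.
by have /= := allrelP uv _ _ xu yv; lia.
Qed.

(** An increasing subsequence cannot pass from u n to v; one inside u extends
    by n. *)
Lemma inc_top l :
  occurs (skew 0 l.+1) w = occurs (skew 0 l) u || occurs (skew 0 l.+1) v.
Proof.
apply/idP/orP => [/occurs_incP[t [tw st ht]]|[/occurs_incP[t [tu st ht]]|]].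
- move: tw; rewrite /w -cat_rcons => /subseq_catP[a [b [tE au bv]]].
  move: ht; rewrite tE pairwise_cat => /and3P[ab ha hb].
  case: (no_ascent au bv ab) => [a0|b0].
    by right; apply/occurs_incP; exists b; rewrite -st tE a0.
  left; apply: (@subseq_rcons_trunc l n t) => //; rewrite tE b0 cats0 //.
- apply/occurs_incP; exists (rcons t n); split.
  + by rewrite /w -cat_rcons -cats1; apply: subseq_trans (prefix_subseq _ _);
      rewrite -cats1 subseq_cat2r.
  + by rewrite size_rcons st.
  + rewrite -cats1 pairwise_cat ht /= andbT allrel1r.
    by apply/allP => x /(mem_subseq tu) /(allP un).
- exact: occurs_sub vw.
Qed.

(** An occurrence has at most one place where it can pass from u n to v, namely
    the descent between its runs.  If it stays in u n then it avoids n, as its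
    last entry is not its largest. *)
Lemma skew_top p q : 0 < q ->
  occurs (skew p.+1 q) w =
  [|| occurs (skew p.+1 q) u, occurs (skew p.+1 q) v
    | occurs (skew 0 p) u && occurs (skew 0 q) v].
Proof.
move=> q0; apply/idP/or3P => [|[||]].
- case/occurs_skewP => t1 [t2 [tw s1 s2 [h1 h2 h3]]].
  move: tw; rewrite /w -cat_rcons => /subseq_catP[a [b [tE au bv]]].
  have aT : take (size a) (t1 ++ t2) = a by rewrite tE take_size_cat.
  have bD : drop (size a) (t1 ++ t2) = b by rewrite tE drop_size_cat.
  have [sa|sa] := ltnP (size a) p.+1.
    have t1E : t1 = a ++ drop (size a) t1.
      rewrite -[LHS](cat_take_drop (size a) t1); congr (_ ++ _).
      by rewrite -[RHS]aT takel_cat // s1 ltnW.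
    have bE : b = drop (size a) t1 ++ t2 by rewrite -bD drop_cat s1 sa.
    (* the passage to v would be inside the upper run t1 *)
    case: (@no_ascent a (drop (size a) t1)) => //.
    - by apply: subseq_trans bv; rewrite bE; apply: prefix_subseq.
    - by move: h1; rewrite t1E pairwise_cat -t1E => /and3P[].
    - move=> a0; constructor 2; apply/occurs_skewP; exists t1, t2; split=> //.
      by rewrite tE a0.
    - by move/(congr1 size); rewrite size_drop s1 /=; lia.
  have aE : a = t1 ++ take (size a - p.+1) t2.
    by rewrite -[LHS]aT take_cat s1 ltnNge sa.
  have t2E : t2 = take (size a - p.+1) t2 ++ b.
    by rewrite -bD drop_cat s1 ltnNge sa /= cat_take_drop.
  set a' := take _ _ in aE t2E.
  (* the passage to v is after the first entries a' of the lower run t2 *)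
  case: (@no_ascent a' b) => //.
  - by apply: subseq_trans au; rewrite aE; apply: suffix_subseq.
  - by move: h2; rewrite t2E pairwise_cat => /and3P[].
  - move=> a'0; constructor 3; apply/andP; split.
      apply: (@subseq_rcons_trunc p n t1) => //.
      by move: au; rewrite aE a'0 cats0.
    by apply/occurs_incP; exists t2; rewrite t2E a'0 in h2 s2 *; split.
  - move=> b0; constructor 1; apply/occurs_skewP; exists t1, t2; split=> //.
    move: au; rewrite -[a]cats0 -b0 -tE => au.
    case/lastP: t2 => [|t2 z] in s2 h3 au {tE t2E aE a' b0 h2 aT bD} *.
      by rewrite -s2 in q0.
    rewrite -rcons_cat in au *; apply: subseq_rcons_last (au).
    case: t1 s1 {h1} h3 au => // y t1 _ /allrelP/(_ y z) h3 au.
    have zy : z < y by apply: h3; rewrite ?mem_rcons inE eqxx.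
    have: y \in rcons u n by apply: (mem_subseq au); rewrite inE eqxx.
    rewrite mem_rcons inE => /predU1P[yn|/(allP un) /= yn]; last by lia.
    by lia.
- exact: occurs_sub uw.
- exact: occurs_sub vw.
- case/andP => /occurs_incP[t1 [t1u s1 h1]] /occurs_incP[t2 [t2v s2 h2]].
  apply/occurs_skewP; exists (rcons t1 n), t2; split=> //.
  - by rewrite /w -cat_rcons; apply: cat_subseq => //; rewrite -!cats1 subseq_cat2r.
  - by rewrite size_rcons s1.
  split=> //.
    rewrite -cats1 pairwise_cat h1 /= andbT allrel1r.
    by apply/allP => x /(mem_subseq t1u) /(allP un).
  apply/allrelP => x y; rewrite mem_rcons inE => /predU1P[->|xt] yt.
    exact: (allP vn) (mem_subseq t2v yt).
  by apply: (allrelP uv); [apply: mem_subseq xt | apply: mem_subseq yt].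
Qed.
End Top.
End Words.

(** * The shape of 132-avoiding words *)

Section Pattern132.
Local Open Scope nat_scope.

Lemma occurs132P (w : seq nat) : reflect
  (exists x z y, subseq [:: x; z; y] w /\ x < y < z) (occurs is132 w).
Proof.
apply: (iffP (occursP _ _)) => [[t tw]|[x [z [y [tw xyz]]]]].
  by case: t tw => [|x [|z [|y []]]] // tw xyz; exists x, z, y.
by exists [:: x; z; y].
Qed.

(** An entry of u below an entry of v would form 132 with n between them;
    otherwise no occurrence can use entries on both sides. *)
Lemma avoids132_top (u v : seq nat) n :
  all (gtn n) u -> all (gtn n) v -> uniq (u ++ v) ->
  ~~ occurs is132 (u ++ n :: v) =
    [&& allrel gtn u v, ~~ occurs is132 u & ~~ occurs is132 v].
Proof.
move=> un vn uvU.
have uw : subseq u (u ++ n :: v) by exact: prefix_subseq.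
have vw : subseq v (u ++ n :: v) by rewrite -cat_rcons; exact: suffix_subseq.
apply/idP/and3P => [w132|[uv u132 v132]].
  split; [|exact: contra (occurs_sub uw) w132|exact: contra (occurs_sub vw) w132].
  apply/allrelP => x y xu yv /=.
  have: x != y.
    apply: contraTneq uvU => xy; rewrite cat_uniq negb_and orbC negb_and.
    by rewrite negbK; apply/orP; left; apply/orP; left;
       apply/hasP; exists y; rewrite -?xy // xy.
  rewrite neq_ltn => /orP[xy|//]; case/negP: w132.
  apply/occurs132P; exists x, n, y; split; last by rewrite xy; exact: (allP vn).
  rewrite -[[:: x; n; y]]/([:: x] ++ n :: [:: y]); apply: cat_subseq.
    by rewrite sub1seq.
  by rewrite /= eqxx sub1seq.
apply/negP => /occurs132P[x [z [y [tw /andP[xy yz]]]]].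
move: tw; rewrite -cat_rcons => /subseq_catP[a [b [tE au bv]]].
have absurd : x \in a -> y \in b -> False.
  move=> /(mem_subseq au) xu /(mem_subseq bv) yv; move: xu.
  rewrite mem_rcons inE => /predU1P[xn|xu].
    by have /= := allP vn _ yv; lia.
  by have /= := allrelP uv _ _ xu yv; lia.
case: a => [|x' [|z' [|y' [|? ?]]]] // in tE au absurd *.
- by case/negP: v132; apply/occurs132P; exists x, z, y; rewrite tE xy.
- by case: tE absurd => <- <-; rewrite !inE !eqxx orbT => /(_ isT isT).
- by case: tE absurd => <- _ <-; rewrite !inE !eqxx => /(_ isT isT).
case: tE => ? ? ? _; subst x' z' y'.
case/negP: u132; apply/occurs132P; exists x, z, y; rewrite xy; split=> //.
apply: (@subseq_rcons_last [:: x; z] y u n) => //.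
have: z \in rcons u n by apply: (mem_subseq au); rewrite !inE eqxx orbT.
rewrite mem_rcons inE => /predU1P[<-|/(allP un) /=]; lia.
Qed.
End Pattern132.

(** * Permutations as words *)

Definition word n (s : 'S_n) : seq nat := [seq val (s i) | i <- enum 'I_n].

Lemma size_word n (s : 'S_n) : size (word s) = n.
Proof. by rewrite size_map size_enum_ord. Qed.

Lemma nth_word n (s : 'S_n) (i : 'I_n) : nth 0%N (word s) i = s i.
Proof.
by rewrite (nth_map i) ?size_enum_ord // nth_ord_enum.
Qed.

Lemma word_inj n : injective (@word n).
Proof.
by move=> s t st; apply/permP => i; apply: val_inj; rewrite /= -!nth_word st.
Qed.

Lemma word_uniq n (s : 'S_n) : uniq (word s).
Proof.
by rewrite map_inj_uniq ?enum_uniq // => i j /val_inj /perm_inj.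
Qed.

Lemma word_perm_iota n (s : 'S_n) : perm_eq (word s) (iota 0 n).
Proof.
apply: uniq_perm; rewrite ?word_uniq ?iota_uniq // => x; rewrite mem_iota add0n /=.
apply/mapP/idP => [[i _ ->]|xn]; first exact: ltn_ord.
by exists (s^-1%g (Ordinal xn)); rewrite ?mem_enum // permKV.
Qed.

Definition order_iso (tau t : seq nat) : bool :=
  (size t == size tau) &&
  [forall i : 'I_(size tau), forall j : 'I_(size tau),
     (nth 0 tau i < nth 0 tau j)%N == (nth 0 t i < nth 0 t j)%N].

Lemma order_isoP tau t : reflect
  (size t = size tau /\ forall i j, (i < size tau)%N -> (j < size tau)%N ->
     (nth 0 tau i < nth 0 tau j)%N = (nth 0 t i < nth 0 t j)%N)
  (order_iso tau t).
Proof.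
apply: (iffP andP) => [[/eqP st /forallP h]|[st h]]; split=> //.
- move=> i j i1 j1.
  by move/forallP/(_ (Ordinal j1))/eqP: (h (Ordinal i1)).
- exact/eqP.
- by apply/forallP => i; apply/forallP => j; rewrite h.
Qed.

Lemma sorted_subseq_iota (l : seq nat) n : sorted ltn l ->
  all (gtn n) l -> subseq l (iota 0 n).
Proof.
move=> ls /allP ln.
suff -> : l = filter [in l] (iota 0 n) by exact: filter_subseq.
apply: (irr_sorted_eq ltn_trans ltnn) => //.
  by apply: sorted_filter; [exact: ltn_trans | exact: iota_ltn_sorted].
move=> x; rewrite mem_filter mem_iota add0n /=.
by case: (boolP (x \in l)) => //= /ln.
Qed.

(** In a word without repetitions a subsequence determines the positions of
    its entries, which gives the positions f back. *)
Lemma contains_word n (s : 'S_n) tau :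
  contains s tau = occurs (order_iso tau) (word s).
Proof.
set w := word s; set k := size tau.
apply/existsP/occursP => [[f /andP[/forallP fi /forallP fs]]|].
  exists [seq val (s (f i)) | i <- enum 'I_k].
    have -> : [seq val (s (f i)) | i <- enum 'I_k] =
        map (nth 0%N w) [seq val (f i) | i <- enum 'I_k].
      by rewrite -map_comp; apply: eq_map => i /=; rewrite nth_word.
    rewrite [X in subseq _ X](_ : w = map (nth 0%N w) (iota 0 n)); last first.
      by rewrite -[n in RHS](size_word s) -[RHS]/(mkseq _ _) mkseq_nth.
    apply: map_subseq; apply: sorted_subseq_iota; last first.
      by apply/allP => _ /mapP[i _ ->]; exact: ltn_ord.
    rewrite sorted_map; apply: (@sub_sorted _ (relpre val ltn)) => [i j ij|].
      by have /forallP/(_ j)/implyP := fi i; apply.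
    by rewrite -sorted_map val_enum_ord iota_ltn_sorted.
  have nthf i (ik : (i < k)%N) :
      nth 0%N [seq val (s (f i)) | i <- enum 'I_k] i = s (f (Ordinal ik)).
    by rewrite (nth_map (Ordinal ik)) ?size_enum_ord // (nth_ord_enum _ (Ordinal ik)).
  apply/order_isoP; split; first by rewrite size_map size_enum_ord.
  move=> i j ik jk; rewrite (nthf i ik) (nthf j jk).
  by have /forallP/(_ (Ordinal jk))/eqP := fs (Ordinal ik).
case=> t tw /order_isoP[st iso_t].
have wU : uniq w := word_uniq s.
have tiw i : (i < k)%N -> nth 0%N t i \in w.
  by move=> ik; apply: (mem_subseq tw); rewrite mem_nth // st.
have lt_index (i : 'I_k) : (index (nth 0%N t i) w < n)%N.
  by rewrite -[n in (_ < n)%N](size_word s) index_mem tiw.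
pose f : {ffun 'I_k -> 'I_n} := [ffun i => Ordinal (lt_index i)].
have sf i : val (s (f i)) = nth 0%N t i.
  by rewrite /= -nth_word ffunE /= nth_index ?tiw.
exists f; apply/andP; split; apply/forallP => i; apply/forallP => j; last first.
  by rewrite -[nat_of_ord (s (f i))]/(val _) -[nat_of_ord (s (f j))]/(val _) !sf iso_t.
apply/implyP => ij; rewrite !ffunE /=.
have /(subseq_pairwise tw)/(pairwiseP 0%N) :
    pairwise (fun x y => index x w < index y w)%N w.
  by apply/(pairwiseP 0%N) => x y xw yw xy; rewrite !index_uniq.
by apply; rewrite // inE st ltn_ord.
Qed.

Section Shapes.
Local Open Scope nat_scope.

Lemma eq_occurs (Q Q' : pred (seq nat)) (w : seq nat) :
  Q =1 Q' -> occurs Q w = occurs Q' w.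
Proof. by move=> eqQ; apply: eq_existsb => m; rewrite eqQ. Qed.

Lemma order_iso132 : order_iso pat132 =1 is132.
Proof.
move=> t; apply/order_isoP/idP => [[]|].
  case: t => [|x [|z [|y []]]] //= _ h.
  have := h 0 2 isT isT; have := h 2 1 isT isT; rewrite /= => <- <- //.
case: t => [|x [|z [|y []]]] //= xyz; split=> // i j.
by case: i => [|[|[|//]]] _; case: j => [|[|[|//]]] _ /=; lia.
Qed.

(** The order type of a skew word, made explicit: it depends on p and on the
    positions only. *)
Lemma skew_nthP p q t : reflect
  (size t = p + q /\ forall i j, i < p + q -> j < p + q ->
     (nth 0 t i < nth 0 t j) =
     (if (i < p) == (j < p) then i < j else p <= i))
  (skew p q t).
Proof.
apply: (iffP and4P) => [[/eqP st h1 h2 h3]|[st h]].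
  split=> // i j ilt jlt.
  have sp : size (take p t) = p by rewrite size_takel // st leq_addr.
  have sq : size (drop p t) = q by rewrite size_drop st addKn.
  have up a b : b < p -> a < b -> nth 0 t a < nth 0 t b.
    move=> bp ab; have ap := ltn_trans ab bp.
    move/(pairwiseP 0): h1 => /(_ a b); rewrite !nth_take //; apply=> //;
    by rewrite inE sp.
  have up' a b : p <= a -> b < p + q -> a < b -> nth 0 t a < nth 0 t b.
    move=> pa bpq ab; have pb : p <= b by apply: leq_trans pa (ltnW ab).
    move/(pairwiseP 0): h2 => /(_ (a - p) (b - p)); rewrite !nth_drop !subnKC //.
    by apply; rewrite ?inE ?sq; lia.
  have dn a b : a < p -> p <= b < p + q -> nth 0 t b < nth 0 t a.
    move=> ap /andP[pb bpq]; apply: (allrelP h3).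
      by rewrite -(nth_take 0 ap); apply: mem_nth; rewrite sp.
    by rewrite -(subnKC pb) -nth_drop; apply: mem_nth; rewrite sq; lia.
  have [ij|ij|->] := ltngtP i j; last by rewrite ltnn eqxx.
  - case: (ltnP j p) => jp; first by rewrite (ltn_trans ij jp) eqxx up.
    case: (ltnP i p) => ip /=; last by rewrite up'.
    by apply/negP => ?; have := @dn i j ip; rewrite jp jlt; lia.
  - case: (ltnP i p) => ip.
      by rewrite (ltn_trans ij ip) /=; have := @up j i ip ij; lia.
    case: (ltnP j p) => jp /=; first by apply: dn; rewrite ?ip.
    by have := @up' j i jp ilt ij; lia.
have sp : size (take p t) = p by rewrite size_takel // st leq_addr.
have sq : size (drop p t) = q by rewrite size_drop st addKn.
split; first exact/eqP.
- apply/(pairwiseP 0) => i j; rewrite !inE sp => ip jp ij.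
  by rewrite /= !nth_take // h ?ip ?jp //; lia.
- apply/(pairwiseP 0) => i j; rewrite !inE sq => ip jp ij.
  by rewrite /= !nth_drop h ?ltn_add2l //; case: ltnP => ?; case: ltnP => ? /=; lia.
- apply/allrelP => x y /(nthP 0)[i ip <-] /(nthP 0)[j jq <-] /=.
  rewrite sp in ip; rewrite sq in jq.
  rewrite nth_take // nth_drop h ?ltn_add2l ?ltn_addr //.
  by rewrite ip ltnNge leq_addr.
Qed.

Lemma order_iso_pat k d : d <= k -> order_iso (pat k d) =1 skew (k - d) d.
Proof.
move=> dk t.
have sP : size (pat k d) = k by rewrite size_cat !size_iota subnK.
have patE i j : i < k -> j < k -> (nth 0 (pat k d) i < nth 0 (pat k d) j) =
    (if (i < k - d) == (j < k - d) then i < j else k - d <= i).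
  have nthE a : a < k -> nth 0 (pat k d) a =
      if a < k - d then d.+1 + a else 1 + (a - (k - d)).
    move=> ak; rewrite nth_cat size_iota; case: ltnP => h.
      by rewrite nth_iota.
    by rewrite nth_iota //; lia.
  by move=> ik jk; rewrite !nthE //; case: (ltnP i) => ?; case: (ltnP j) => ? /=; lia.
apply/order_isoP/skew_nthP; rewrite sP subnK // => -[st h]; split=> // i j ik jk.
  by rewrite -h // patE.
by rewrite h // patE.
Qed.

(** * Inversions and signs *)

Fixpoint inv (w : seq nat) : nat :=
  if w is x :: w' then count (gtn x) w' + inv w' else 0.

Lemma inv_insert_max (u v : seq nat) n : all (gtn n) u -> all (gtn n) v ->
  inv (u ++ n :: v) = inv (u ++ v) + size v.
Proof.
elim: u => [|x u IHu] /= un vn.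
  by rewrite addnC; congr (_ + _); apply/eqP; rewrite -all_count.
case/andP: un => xn un; rewrite IHu // !count_cat /=.
by rewrite (ltnNge n x) (ltnW xn) /= add0n !addnA.
Qed.

Lemma inv_skew (u v : seq nat) : allrel gtn u v ->
  inv (u ++ v) = inv u + inv v + size u * size v.
Proof.
elim: u => [|x u IHu] /=; first by rewrite addn0.
rewrite allrel_consl => /andP[xv uv]; rewrite IHu // count_cat.
by move: xv; rewrite all_count => /eqP ->; lia.
Qed.

Lemma inv_mapD m w : inv (map (addn m) w) = inv w.
Proof.
elim: w => //= x w ->; congr (_ + _); rewrite count_map.
by apply: eq_count => y /=; rewrite ltn_add2l.
Qed.

End Shapes.

Lemma perm_iota_lt (w : seq nat) n : perm_eq w (iota 0 n) -> all (gtn n) w.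
Proof. by move=> wP; apply/allP => x; rewrite (perm_mem wP) mem_iota. Qed.

Lemma perm_insert_max (u v : seq nat) n :
  perm_eq (u ++ n :: v) (iota 0 n.+1) = perm_eq (u ++ v) (iota 0 n).
Proof.
rewrite -[n.+1]addn1 iotaD (permPr (permEl (perm_catC _ _))) /= add0n.
by rewrite (permPl (permEl (perm_catCA u [:: n] v))) perm_cons.
Qed.

(** Inserting the largest value n at position i corresponds to [lift_perm], which
    changes the sign by the parity of n - i, and adds n - i inversions. *)
Lemma word_surj_sign n (w : seq nat) : perm_eq w (iota 0 n) ->
  exists2 s : 'S_n, word s = w & odd_perm s = odd (inv w).
Proof.
elim: n w => [|n IHn] w wP.
  move/perm_nilP: wP => ->; exists 1%g; last by rewrite odd_perm1.
  by apply: size0nil; rewrite size_word.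
have nw : n \in w by rewrite (perm_mem wP) mem_iota ltnS leqnn.
case/splitPr: nw wP => u v wP.
have uvP : perm_eq (u ++ v) (iota 0 n) by rewrite -perm_insert_max.
have := perm_iota_lt uvP; rewrite all_cat => /andP[un vn].
have [s sw so] := IHn _ uvP.
have suv : (size u + size v)%N = n by rewrite -size_cat (perm_size uvP) size_iota.
have un1 : (size u < n.+1)%N by rewrite ltnS -suv leq_addr.
exists (lift_perm (Ordinal un1) ord_max s); last first.
  rewrite odd_lift_perm /= inv_insert_max // so oddD -[in odd n]suv oddD.
  by case: (odd (size u)); case: (odd (size v)); case: (odd (inv _)).
apply: (@eq_from_nth _ 0%N); first by rewrite size_word size_cat /= addnS suv.
move=> i; rewrite size_word => ilt.
rewrite (nth_word _ (Ordinal ilt)) nth_cat.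
have [j jE|jE] := unliftP (Ordinal un1) (Ordinal ilt); rewrite jE.
  have iE : i = bump (size u) j by rewrite -[i]/(nat_of_ord (Ordinal ilt)) jE.
  rewrite lift_perm_lift /= /bump leqNgt ltn_ord add0n -nth_word sw nth_cat iE.
  rewrite /bump; case: (ltnP j (size u)) => ju; first by rewrite add0n ju.
  by rewrite add1n ltnNge (leqW ju) /= subSn.
have iE : i = size u by rewrite -[i]/(nat_of_ord (Ordinal ilt)) jE.
by rewrite lift_perm_id iE ltnn subnn.
Qed.

Lemma odd_perm_word n (s : 'S_n) : odd_perm s = odd (inv (word s)).
Proof.
by have [t /word_inj <- ->] := word_surj_sign (word_perm_iota s).
Qed.

Lemma perm_words n :
  perm_eq [seq word s | s : 'S_n <- index_enum _] (permutations (iota 0 n)).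
Proof.
apply: uniq_perm; rewrite ?permutations_uniq //.
  by rewrite map_inj_uniq ?index_enum_uniq //; apply: word_inj.
move=> w; rewrite mem_permutations.
apply/mapP/idP => [[s _ ->]|wP]; first exact: word_perm_iota.
by have [s <- _] := word_surj_sign wP; exists s; rewrite ?mem_index_enum.
Qed.

(** * Signed counts and their recurrences *)

(** Words on the values m, ..., m + n - 1: cutting a permutation at its maximum
    produces words whose values do not start at 0. *)
Definition avoiders (m n : nat) : seq (seq nat) :=
  [seq w <- permutations (iota m n) | ~~ occurs is132 w].

Lemma mem_avoiders m n w :
  (w \in avoiders m n) = ~~ occurs is132 w && perm_eq w (iota m n).
Proof. by rewrite mem_filter mem_permutations. Qed.

Lemma avoiders_uniq m n : uniq (avoiders m n).
Proof. by rewrite filter_uniq ?permutations_uniq. Qed.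

Lemma occurs_map (Q : pred (seq nat)) (f : nat -> nat) (w : seq nat) :
  (forall t, Q (map f t) = Q t) -> occurs Q (map f w) = occurs Q w.
Proof.
move=> Qf; apply/occursP/occursP => [[t /subseqP[m _ ->]]|[t tw Qt]].
  by rewrite -map_mask Qf => Qm; exists (mask m w); rewrite ?mask_subseq.
by exists (map f t); rewrite ?map_subseq ?Qf.
Qed.

Lemma is132_shift m t : is132 (map (addn m) t) = is132 t.
Proof. by case: t => [|x [|z [|y []]]] //=; rewrite !ltn_add2l. Qed.

Lemma skew_shift m p q t : skew p q (map (addn m) t) = skew p q t.
Proof.
rewrite /skew size_map -map_take -map_drop !pairwise_map allrel_mapl allrel_mapr.
congr [&& _, _, _ & _].
- by apply: eq_pairwise => x y /=; rewrite ltn_add2l.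
- by apply: eq_pairwise => x y /=; rewrite ltn_add2l.
- by apply: eq_allrel => x y /=; rewrite ltn_add2l.
Qed.

Lemma avoiders_shift m n :
  perm_eq (avoiders m n) (map (map (addn m)) (avoiders 0 n)).
Proof.
apply: uniq_perm; rewrite ?avoiders_uniq //.
  by rewrite map_inj_uniq ?avoiders_uniq //; apply/inj_map/addnI.
move=> w; apply/idP/mapP => [|[w0 + ->]]; rewrite !mem_avoiders; last first.
  rewrite occurs_map; last exact: is132_shift.
  by case/andP => -> /(perm_map (addn m)); rewrite -iotaDl addn0.
case/andP => w132 wP; have wE : w = map (addn m) (map (subn^~ m) w).
  rewrite -map_comp -[LHS]map_id; apply/eq_in_map => x /=.
  by rewrite (perm_mem wP) mem_iota => /andP[mx _]; rewrite subnKC.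
exists (map (subn^~ m) w) => //; rewrite mem_avoiders.
rewrite -(@occurs_map _ (addn m)) -?wE ?w132; last exact: is132_shift.
by apply: (perm_map_inj (@addnI m)); rewrite -wE -iotaDl addn0.
Qed.

Definition sgn (w : seq nat) : rat := (-1) ^+ inv w.

Definition avsum (m p q n : nat) : rat :=
  \sum_(w <- avoiders m n) (~~ occurs (skew p q) w)%:R * sgn w.

Lemma avsum_shift m p q n : avsum m p q n = avsum 0 p q n.
Proof.
rewrite /avsum (perm_big _ (avoiders_shift m n)) /= big_map.
apply: eq_bigr => w _; rewrite /sgn inv_mapD occurs_map //.
exact: skew_shift.
Qed.

Lemma M_avsum k d n : (d <= k)%N -> M_ (pat k d) n = avsum 0 (k - d) d n.
Proof.
move=> dk; rewrite /M_ /E_ /O_ /avsum big_filter -(perm_big _ (perm_words n)) /=.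
rewrite big_map -!sum1_card !natr_sum.
rewrite big_mkcond [X in _ - X]big_mkcond -sumrB [RHS]big_mkcond.
apply: eq_bigr => s _; rewrite !inE /avoids !contains_word.
rewrite (eq_occurs _ order_iso132) (eq_occurs _ (order_iso_pat dk)).
rewrite /sgn -signr_odd -odd_perm_word.
by case: odd_perm; case: occurs; case: occurs; rewrite /=
  ?mul0r ?mul1r ?subrr ?sub0r ?subr0.
Qed.

(** If u lies above v, sorting both and putting u last sorts the whole word. *)
Lemma perm_skew_split (u v : seq nat) n : allrel gtn u v ->
  perm_eq (u ++ v) (iota 0 n) ->
  perm_eq u (iota (size v) (size u)) /\ perm_eq v (iota 0 (size v)).
Proof.
move=> uv uvP.
have nE : n = (size v + size u)%N.
  by rewrite addnC -size_cat (perm_size uvP) size_iota.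
have /eqP : sort leq v ++ sort leq u = iota 0 n.
  apply: (sorted_eq leq_trans anti_leq); last 1 first.
  - apply: perm_trans uvP; rewrite perm_catC.
    by apply: perm_cat; rewrite perm_sort.
  - rewrite (sorted_pairwise leq_trans) pairwise_cat.
    rewrite -!(sorted_pairwise leq_trans) !sort_sorted ?andbT; try exact: leq_total.
    apply/allrelP => x y; rewrite !mem_sort => xv yu.
    exact: ltnW (allrelP uv _ _ yu xv).
  - exact: iota_sorted.
rewrite nE iotaD eqseq_cat ?size_sort ?size_iota // => /andP[/eqP vE /eqP uE].
rewrite -[in X in perm_eq u X]uE -[in X in perm_eq v X]vE.
by rewrite ![perm_eq _ (sort _ _)]perm_sym !perm_sort.
Qed.

Lemma iota_gt a b (u v : seq nat) : perm_eq u (iota a b) ->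
  perm_eq v (iota 0 a) -> allrel gtn u v.
Proof.
move=> uP vP; apply/allrelP => x y.
rewrite (perm_mem uP) (perm_mem vP) !mem_iota add0n /= => /andP[ax _] ya.
exact: leq_trans ya ax.
Qed.

Lemma avoiders_cut n i : (i <= n)%N ->
  perm_eq [seq w <- avoiders 0 n.+1 | index n w == i]
    [seq u ++ n :: v | u <- avoiders (n - i) i, v <- avoiders 0 (n - i)].
Proof.
move=> lein; apply: uniq_perm.
- by rewrite filter_uniq ?avoiders_uniq.
- apply: allpairs_uniq; rewrite ?avoiders_uniq //.
  move=> _ _ /allpairsP[[u v] /= [uP _ ->]] /allpairsP[[u' v'] /= [uP' _ ->]] /=.
  move: uP uP'; rewrite !mem_avoiders => /andP[_ /perm_size su] /andP[_ /perm_size su'].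
  move/eqP; rewrite eqseq_cat; last by rewrite su su' !size_iota.
  by case/andP => /eqP -> /eqP[->].
move=> w; rewrite mem_filter mem_avoiders.
apply/andP/allpairsP => [[/eqP iw /andP[w132 wP]]|[[u v] /=]].
  have nw : n \in w by rewrite (perm_mem wP) mem_iota ltnS leqnn.
  have wU : uniq w by rewrite (perm_uniq wP) iota_uniq.
  case/splitPr: nw iw w132 wP wU => u v iw w132 wP wU.
  have uvP : perm_eq (u ++ v) (iota 0 n) by rewrite -perm_insert_max.
  have uvU : uniq (u ++ v) by rewrite (perm_uniq uvP) iota_uniq.
  have := perm_iota_lt uvP; rewrite all_cat => /andP[un vn].
  have nu : n \notin u by apply/negP => /(allP un) /=; rewrite ltnn.
  have su : size u = i by rewrite -iw index_cat (negPf nu) /= eqxx addn0.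
  have sv : size v = (n - i)%N.
    by rewrite -(size_iota 0 n) -(perm_size uvP) size_cat su addKn.
  move: w132; rewrite avoids132_top // => /and3P[uv u132 v132].
  have [uP vP] := perm_skew_split uv uvP.
  by exists (u, v); rewrite /= !mem_avoiders u132 v132 -sv -su uP vP.
rewrite !mem_avoiders => -[/andP[u132 uP] /andP[v132 vP] ->].
have uv := iota_gt uP vP.
have uvP : perm_eq (u ++ v) (iota 0 n).
  by rewrite -(subnK lein) iotaD perm_catC perm_cat.
have := perm_iota_lt uvP; rewrite all_cat => /andP[un vn].
rewrite avoids132_top ?uv ?u132 ?v132 ?(perm_uniq uvP) ?iota_uniq //.
have nu : n \notin u by apply/negP => /(allP un) /=; rewrite ltnn.
rewrite index_cat (negPf nu) index_head addn0 (perm_size uP) size_iota; split=> //.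
by rewrite /= -[0%N :: iota 1 n]/(iota 0 n.+1) perm_insert_max.
Qed.

Lemma avoiders_top n i u v : (i <= n)%N ->
  u \in avoiders (n - i) i -> v \in avoiders 0 (n - i) ->
  [/\ all (gtn n) u, all (gtn n) v & allrel gtn u v].
Proof.
rewrite !mem_avoiders => lein /andP[_ uP] /andP[_ vP].
have : all (gtn n) (u ++ v).
  by apply: perm_iota_lt; rewrite -(subnK lein) iotaD perm_catC perm_cat.
by rewrite all_cat => /andP[un vn]; split=> //; apply: iota_gt uP vP.
Qed.

(** The twist: n is above the [size v] entries that follow it, and all pairs
    across u and v are inversions. *)
Lemma sgn_top (u v : seq nat) n : all (gtn n) u -> all (gtn n) v ->
  allrel gtn u v -> sgn (u ++ n :: v) =
    (-1) ^+ ((size u).+1 * size v) * (sgn u * sgn v).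
Proof.
move=> un vn uv; rewrite /sgn inv_insert_max // inv_skew // -!exprD.
by congr (_ ^+ _); lia.
Qed.

Lemma sum_avoiders_top n (Q : pred (seq nat)) :
  \sum_(w <- avoiders 0 n.+1) (Q w)%:R * sgn w =
  \sum_(i < n.+1) (-1) ^+ (i.+1 * (n - i)) *
     \sum_(u <- avoiders (n - i) i) \sum_(v <- avoiders 0 (n - i))
        (Q (u ++ n :: v))%:R * (sgn u * sgn v).
Proof.
rewrite big_seq (partition_big (fun w => inord (index n w) : 'I_n.+1) xpredT) //=.
apply: eq_bigr => i _; have lein : (i <= n)%N by rewrite -ltnS.
transitivity
  (\sum_(w <- [seq w <- avoiders 0 n.+1 | index n w == i]) (Q w)%:R * sgn w).
  rewrite big_filter [RHS]big_seq_cond; apply: eq_bigl => w.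
  case: (boolP (w \in _)) => //=; rewrite mem_avoiders => /andP[_ wP].
  rewrite -val_eqE /= inordK // -(size_iota 0 n.+1) -(perm_size wP) index_mem.
  by rewrite (perm_mem wP) mem_iota ltnS leqnn.
rewrite (perm_big _ (avoiders_cut lein)) /= big_allpairs_dep /= big_distrr /=.
apply: eq_big_seq => u uA; rewrite big_distrr /=; apply: eq_big_seq => v vA.
have [un vn uv] := avoiders_top lein uA vA; rewrite sgn_top //.
move: uA vA; rewrite !mem_avoiders => /andP[_ uP] /andP[_ vP].
by rewrite (perm_size uP) (perm_size vP) !size_iota mulrCA.
Qed.

Definition tconv (f g : nat -> rat) (n : nat) : rat :=
  \sum_(i < n.+1) (-1) ^+ (i.+1 * (n - i)) * (f i * g (n - i)%N).

(** The start m of the values in u is free by translation invariance. *)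
Lemma avsum_mul p q p' q' m i j :
  avsum 0 p q i * avsum 0 p' q' j =
  \sum_(u <- avoiders m i) \sum_(v <- avoiders 0 j)
     (~~ occurs (skew p q) u)%:R * (~~ occurs (skew p' q') v)%:R
     * (sgn u * sgn v).
Proof.
rewrite -(avsum_shift m) /avsum big_distrlr /=.
by apply: eq_bigr => u _; apply: eq_bigr => v _; rewrite mulrACA.
Qed.

Lemma avsum_inc_rec l n :
  avsum 0 0 l.+1 n.+1 = tconv (avsum 0 0 l) (avsum 0 0 l.+1) n.
Proof.
rewrite [LHS](sum_avoiders_top n (fun w => ~~ occurs (skew 0 l.+1) w)).
apply: eq_bigr => i _; have lein : (i <= n)%N by rewrite -ltnS.
congr (_ * _); rewrite (avsum_mul _ _ _ _ (n - i)).
apply: eq_big_seq => u uA; apply: eq_big_seq => v vA.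
have [un vn uv] := avoiders_top lein uA vA.
by rewrite inc_top // negb_or -natrM mulnb.
Qed.

Lemma occurs_skew_inc p q w : occurs (skew p.+1 q) w ->
  occurs (skew 0 p) w && occurs (skew 0 q) w.
Proof.
case/occurs_skewP => t1 [t2 [tw s1 s2 [h1 h2 _]]]; apply/andP; split.
  apply: (@occurs_inc_le p t1) => //; first by rewrite s1.
  exact: subseq_trans (prefix_subseq _ _) tw.
apply: (@occurs_inc_le q t2) => //; first by rewrite s2.
exact: subseq_trans (suffix_subseq _ _) tw.
Qed.

(** By [skew_top], u n v avoids the pattern when u and v do and moreover u
    avoids the increasing run of length p or v avoids that of length q, which
    are stronger conditions on u and on v; the three terms are
    inclusion-exclusion for this disjunction. *)
Lemma avsum_skew_rec p q n : (0 < q)%N ->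
  avsum 0 p.+1 q n.+1 =
    tconv (avsum 0 0 p) (avsum 0 p.+1 q) n
    + tconv (avsum 0 p.+1 q) (avsum 0 0 q) n
    - tconv (avsum 0 0 p) (avsum 0 0 q) n.
Proof.
move=> q0; rewrite [LHS](sum_avoiders_top n (fun w => ~~ occurs (skew p.+1 q) w)).
rewrite -big_split -sumrB /=.
apply: eq_bigr => i _; have lein : (i <= n)%N by rewrite -ltnS.
rewrite -mulrDr -mulrBr; congr (_ * _).
rewrite !(avsum_mul _ _ _ _ (n - i)) -big_split -sumrB /=.
apply: eq_big_seq => u uA; rewrite -big_split -sumrB /=.
apply: eq_big_seq => v vA.
have [un vn uv] := avoiders_top lein uA vA.
rewrite skew_top // -mulrDl -mulrBl; congr (_ * _).
have := @occurs_skew_inc p q v; have := @occurs_skew_inc p q u.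
case: (occurs (skew p.+1 q) u) => [/(_ isT)/andP[-> _] _|_] /=.
  by rewrite !mul0r !add0r oppr0.
case: (occurs (skew p.+1 q) v) => [/(_ isT)/andP[_ ->]|_] /=.
  by rewrite !mulr0 !add0r oppr0.
by case: (occurs (skew 0 p) u); case: (occurs (skew 0 q) v);
  rewrite /= ?mul0r ?mul1r ?mulr0 ?addr0 ?add0r ?subr0 ?subrr // addrK.
Qed.

Lemma avsum0 p q : avsum 0 p q 0 = (0 < p + q)%N%:R.
Proof.
rewrite /avsum (_ : avoiders 0 0 = [:: [::]]) ?big_seq1; last first.
  rewrite /avoiders /= (_ : occurs is132 [::] = false) //.
  by apply/negbTE/negP => /occursP[t]; rewrite subseq0 => /eqP ->.
rewrite /sgn expr0 mulr1; congr (nat_of_bool _)%:R.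
rewrite lt0n addn_eq0; congr (~~ _); apply/occurs_skewP/andP => [|[/eqP -> /eqP ->]].
  by case=> t1 [t2 []]; rewrite subseq0 -size_eq0 size_cat addn_eq0 => h <- <-; case/andP: h.
by exists [::], [::].
Qed.

Lemma avsum_inc0 n : avsum 0 0 0 n = 0.
Proof. by apply: big1 => w _; rewrite occurs_inc0 mul0r. Qed.

(** * Even and odd parts of truncated power series *)

Lemma dvdXnP N (p : {poly rat}) : reflect (forall i, (i < N)%N -> p`_i = 0) ('X^N %| p).
Proof.
apply: (iffP idP) => [/dvdpP[q ->] i iN|h]; first by rewrite coefMXn iN.
rewrite -(poly_take_drop N p) (_ : take_poly N p = 0).
  by rewrite add0r dvdp_mull.
by apply/polyP => i; rewrite coef_take_poly coef0; case: ifP => // /h.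
Qed.

Lemma dvdXn_cancel N (p q : {poly rat}) : p.[0] != 0 -> 'X^N %| p * q -> 'X^N %| q.
Proof.
by move=> p0; rewrite Gauss_dvdpr // coprimep_expl // coprimep_sym coprimepX.
Qed.

Definition evpart N (f : nat -> rat) : {poly rat} :=
  \poly_(i < N) (if odd i then 0 else f i).
Definition odpart N (f : nat -> rat) : {poly rat} :=
  \poly_(i < N) (if odd i then f i else 0).

Lemma coef_prefix N (c d : nat -> rat) n : (n < N)%N ->
  (\poly_(i < N) c i * \poly_(i < N) d i)`_n = \sum_(i < n.+1) c i * d (n - i)%N.
Proof.
move=> nN; rewrite coefM; apply: eq_bigr => i _.
have iN : (i < N)%N by apply: leq_ltn_trans nN; rewrite -ltnS.
by rewrite !coef_poly iN (leq_ltn_trans (leq_subr _ _) nN).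
Qed.

(** For a + b even, (a + 1) b is even. *)
Lemma evpart_tconv N f g :
  'X^N %| evpart N (tconv f g) - (evpart N f * evpart N g + odpart N f * odpart N g).
Proof.
apply/dvdXnP => n nN; rewrite !coefB coefD !coef_prefix // coef_poly nN.
rewrite -big_split /=; apply/eqP; rewrite subr_eq0; apply/eqP.
case: ifPn => on; last (apply: eq_bigr => i _); first (symmetry; apply: big1 => i _).
  all: have lein : (i <= n)%N by rewrite -ltnS.
  all: have := oddB lein; rewrite ?(negPf on) ?on => ob.
  by rewrite ob; case: odd; rewrite ?mulr0 ?mul0r addr0.
rewrite -signr_odd oddM /= ob.
by case: odd; rewrite /= ?mulr0 ?mul0r ?add0r ?addr0 expr0 mul1r.
Qed.

(** For a + b odd, (a + 1) b is odd exactly when a is even. *)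
Lemma odpart_tconv N f g :
  'X^N %| odpart N (tconv f g) - (odpart N f * evpart N g - evpart N f * odpart N g).
Proof.
apply/dvdXnP => n nN; rewrite !coefB !coef_prefix // coef_poly nN.
rewrite -sumrB /=; apply/eqP; rewrite subr_eq0; apply/eqP.
case: ifPn => on; first (apply: eq_bigr => i _); last (symmetry; apply: big1 => i _).
  all: have lein : (i <= n)%N by rewrite -ltnS.
  all: have := oddB lein; rewrite ?(negPf on) ?on => ob.
  rewrite -signr_odd oddM /= ob.
  by case: odd; rewrite /= ?mulr0 ?mul0r ?sub0r ?subr0 ?expr0 ?expr1 ?mul1r ?mulN1r.
by rewrite ob; case: odd; rewrite ?mulr0 ?mul0r subr0.
Qed.

Lemma evpart_succ N f g : (forall n, f n.+1 = g n) ->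
  'X^N %| evpart N f - ((f 0%N)%:P + 'X * odpart N g).
Proof.
move=> fg; apply/dvdXnP => -[|n] nN; rewrite coefB coefD coefXM coefC !coef_poly nN /=.
  by rewrite addr0 subrr.
by rewrite (ltnW nN) fg; case: odd; rewrite /= add0r subrr.
Qed.

Lemma odpart_succ N f g : (forall n, f n.+1 = g n) ->
  'X^N %| odpart N f - 'X * evpart N g.
Proof.
move=> fg; apply/dvdXnP => -[|n] nN; rewrite coefB coefXM !coef_poly nN /=.
  by rewrite subrr.
by rewrite (ltnW nN) fg; case: odd; rewrite /= subrr.
Qed.

Lemma evpartD N f g : evpart N (fun n => f n + g n) = evpart N f + evpart N g.
Proof.
by apply/polyP => i; rewrite coefD !coef_poly; case: ifP; case: odd; rewrite ?addr0.
Qed.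
Lemma odpartD N f g : odpart N (fun n => f n + g n) = odpart N f + odpart N g.
Proof.
by apply/polyP => i; rewrite coefD !coef_poly; case: ifP; case: odd; rewrite ?addr0.
Qed.
Lemma evpartB N f g : evpart N (fun n => f n - g n) = evpart N f - evpart N g.
Proof.
by apply/polyP => i; rewrite coefB !coef_poly; case: ifP; case: odd; rewrite ?subr0.
Qed.
Lemma odpartB N f g : odpart N (fun n => f n - g n) = odpart N f - odpart N g.
Proof.
by apply/polyP => i; rewrite coefB !coef_poly; case: ifP; case: odd; rewrite ?subr0.
Qed.

Lemma inc_ev N l (f := avsum 0 0 l) (g := avsum 0 0 l.+1) :
  'X^N %| evpart N g - (1 + 'X * (odpart N f * evpart N g - evpart N f * odpart N g)).
Proof.
have := evpart_succ N (avsum_inc_rec l); rewrite avsum0 /= -/f -/g.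
have := odpart_tconv N f g; set t := odpart N (tconv f g) => h1 h2.
rewrite (_ : _ - _ = (evpart N g - (1 + 'X * t))
    + 'X * (t - (odpart N f * evpart N g - evpart N f * odpart N g))); last by ring.
by rewrite dvdp_add // dvdp_mull.
Qed.

Lemma inc_od N l (f := avsum 0 0 l) (g := avsum 0 0 l.+1) :
  'X^N %| odpart N g - 'X * (evpart N f * evpart N g + odpart N f * odpart N g).
Proof.
have := odpart_succ N (avsum_inc_rec l); rewrite -/f -/g.
have := evpart_tconv N f g; set t := evpart N (tconv f g) => h1 h2.
rewrite (_ : _ - _ = (odpart N g - 'X * t)
    + 'X * (t - (evpart N f * evpart N g + odpart N f * odpart N g))); last by ring.
by rewrite dvdp_add // dvdp_mull.
Qed.

Lemma skew_ev N (p q : nat) (A := avsum 0 0 p) (B := avsum 0 0 q) (F := avsum 0 p.+1 q) :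
  (0 < q)%N ->
  'X^N %| evpart N F - (1 + 'X * ((odpart N A * evpart N F - evpart N A * odpart N F)
    + (odpart N F * evpart N B - evpart N F * odpart N B)
    - (odpart N A * evpart N B - evpart N A * odpart N B))).
Proof.
move=> q0; have := evpart_succ N (fun n => @avsum_skew_rec p q n q0).
rewrite avsum0 polyC1 -/A -/B -/F odpartB odpartD.
move=> h; set G := (X in 'X^N %| X); set t := (X in 'X * X) in h.
rewrite (_ : G = evpart N F - (1 + 'X * t) + 'X * (
    (odpart N (tconv A F) - (odpart N A * evpart N F - evpart N A * odpart N F))
    + (odpart N (tconv F B) - (odpart N F * evpart N B - evpart N F * odpart N B))
    - (odpart N (tconv A B) - (odpart N A * evpart N B - evpart N A * odpart N B)))).
  apply: dvdp_add h _; apply: dvdp_mull.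
  by apply: dvdp_sub (odpart_tconv _ _ _); apply: dvdp_add; apply: odpart_tconv.
by rewrite /G /t; ring.
Qed.

Lemma skew_od N (p q : nat) (A := avsum 0 0 p) (B := avsum 0 0 q) (F := avsum 0 p.+1 q) :
  (0 < q)%N ->
  'X^N %| odpart N F - 'X * ((evpart N A * evpart N F + odpart N A * odpart N F)
    + (evpart N F * evpart N B + odpart N F * odpart N B)
    - (evpart N A * evpart N B + odpart N A * odpart N B)).
Proof.
move=> q0; have := odpart_succ N (fun n => @avsum_skew_rec p q n q0).
rewrite -/A -/B -/F evpartB evpartD.
move=> h; set G := (X in 'X^N %| X); set t := (X in 'X * X) in h.
rewrite (_ : G = odpart N F - 'X * t + 'X * (
    (evpart N (tconv A F) - (evpart N A * evpart N F + odpart N A * odpart N F))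
    + (evpart N (tconv F B) - (evpart N F * evpart N B + odpart N F * odpart N B))
    - (evpart N (tconv A B) - (evpart N A * evpart N B + odpart N A * odpart N B)))).
  apply: dvdp_add h _; apply: dvdp_mull.
  by apply: dvdp_sub (evpart_tconv _ _ _); apply: dvdp_add; apply: evpart_tconv.
by rewrite /G /t; ring.
Qed.

(** * The fractions R_j(x^2) and the solution of the recurrences *)

(** R_j(x^2) = num j / den j; the shift num (j + 1) = den j comes from
    R_(j+1) = 1 / (1 - x R_j). *)
Definition den j : {poly rat} := chebV j \Po 'X^2.
Definition num j : {poly rat} := if j is j'.+1 then den j' else 0.

Lemma denS j : den j.+1 = den j - 'X^2 * num j.
Proof.
case: j => [|j]; first by rewrite /= mulr0 subr0.
by rewrite /den [chebV _]/= -/(chebV j.+1) comp_polyB comp_polyM comp_polyX.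
Qed.

Lemma den_horner0 j : (den j).[0] = 1.
Proof. by rewrite /den horner_comp hornerXn expr0n horner_coef0 chebV_coef0. Qed.

(** The addition formula for Chebyshev polynomials; the second half makes the
    induction work and is the numerator of R_(a+d+1). *)
Lemma den_add a d :
  den (a + d).+1 = den a.+1 * den d - 'X^2 * (den a * num d) /\
  den (a + d) = den a * den d - 'X^2 * (num a * num d).
Proof.
elim: a => [|a [IH1 IH2]].
  have den_0 : den 0 = 1 by rewrite /den /= comp_polyC.
  by rewrite add0n !denS /= den_0; split; ring.
by rewrite addSn; split=> //; rewrite (denS (a + d).+1) (denS a.+1) /= IH1 IH2 (denS a); ring.
Qed.

(** From I_(2j+1) = e + o through I_(2j+2) = E + O to I_(2j+3) = E' + O', with
    R_j = Z / W and W' = W - X^2 Z the next denominator.  The chain is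
    O = X R E, E = R (1 - X O), then O' = X R E' after cancelling 1 - X O, then
    E' = 1, where R = W / W' is R_(j+1). *)
Lemma inc_odd_step N (e o E O E' O' W Z : {poly rat}) :
  (W - 'X^2 * Z).[0] != 0 ->
  'X^N %| e - 1 -> 'X^N %| W * o - 'X * Z ->
  'X^N %| E - (1 + 'X * (o * E - e * O)) -> 'X^N %| O - 'X * (e * E + o * O) ->
  'X^N %| E' - (1 + 'X * (O * E' - E * O')) ->
  'X^N %| O' - 'X * (E * E' + O * O') ->
  'X^N %| E' - 1 /\ 'X^N %| (W - 'X^2 * Z) * O' - 'X * W.
Proof.
move=> W'0 he ho hE hO hE' hO'; set W' := W - _ in W'0 *.
have h1 : 'X^N %| W' * O - 'X * W * E.
  suff -> : W' * O - 'X * W * E = W * (O - 'X * (e * E + o * O))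
      + 'X * W * E * (e - 1) + 'X * O * (W * o - 'X * Z).
    by rewrite !dvdp_add // dvdp_mull.
  by rewrite /W'; ring.
have h2 : 'X^N %| W' * E - W * (1 - 'X * O).
  suff -> : W' * E - W * (1 - 'X * O) = W * (E - (1 + 'X * (o * E - e * O)))
      + 'X * E * (W * o - 'X * Z) - 'X * W * O * (e - 1).
    by rewrite dvdp_sub ?dvdp_add // dvdp_mull.
  by rewrite /W'; ring.
have h3 : 'X^N %| W' * O' - 'X * W * E'.
  apply: (@dvdXn_cancel _ (1 - 'X * O)).
    by rewrite hornerD hornerN hornerM hornerX mul0r subr0 hornerC oner_eq0.
  suff -> : (1 - 'X * O) * (W' * O' - 'X * W * E') =
      W' * (O' - 'X * (E * E' + O * O')) + 'X * E' * (W' * E - W * (1 - 'X * O)).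
    by rewrite dvdp_add // dvdp_mull.
  by ring.
have h4 : 'X^N %| E' - 1.
  apply: (dvdXn_cancel W'0).
  suff -> : W' * (E' - 1) = W' * (E' - (1 + 'X * (O * E' - E * O')))
      + 'X * E' * (W' * O - 'X * W * E) - 'X * E * (W' * O' - 'X * W * E').
    by rewrite dvdp_sub ?dvdp_add // dvdp_mull.
  by ring.
split=> //.
suff -> : W' * O' - 'X * W = W' * O' - 'X * W * E' + 'X * W * (E' - 1).
  by rewrite dvdp_add // dvdp_mull.
by ring.
Qed.

(** f = 1 + x R_j(x^2) modulo x^N, with the denominator cleared. *)
Definition agrees N j (f : nat -> rat) : Prop :=
  'X^N %| evpart N f - 1 /\ 'X^N %| den j * odpart N f - 'X * num j.

Lemma inc_agrees N j : agrees N j (avsum 0 0 (2 * j).+1).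
Proof.
elim: j => [|j [IHe IHo]].
  have z0 : evpart N (avsum 0 0 0) = 0 /\ odpart N (avsum 0 0 0) = 0.
    by split; apply/polyP => i; rewrite coef_poly coef0 avsum_inc0; case: ifP; case: odd.
  have := inc_ev N 0; have := inc_od N 0; rewrite /=; case: z0 => -> ->.
  rewrite /agrees muln0 !mul0r subrr addr0 !mulr0 addr0 subr0 => h1 h2.
  by split=> //; rewrite subr0 dvdp_mull.
rewrite (_ : 2 * j.+1 = (2 * j).+2)%N; last by lia.
rewrite /agrees denS; apply: (inc_odd_step _ IHe IHo (inc_ev _ _) (inc_od _ _)
  (inc_ev _ _) (inc_od _ _)).
by rewrite -denS den_horner0 oner_eq0.
Qed.

(** With A = 1 + x R_A, B = 1 + x R_B the equation for the even part of F becomes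
    (eF - 1) (1 - X (oA - oB)) = 0, and then the one for the odd part becomes
    linear in oF. *)
Lemma skew_step N (eA oA eB oB eF oF WA ZA WB ZB : {poly rat}) :
  'X^N %| eA - 1 -> 'X^N %| WA * oA - 'X * ZA ->
  'X^N %| eB - 1 -> 'X^N %| WB * oB - 'X * ZB ->
  'X^N %| eF - (1 + 'X * ((oA * eF - eA * oF) + (oF * eB - eF * oB)
                          - (oA * eB - eA * oB))) ->
  'X^N %| oF - 'X * ((eA * eF + oA * oF) + (eF * eB + oF * oB)
                          - (eA * eB + oA * oB)) ->
  'X^N %| eF - 1 /\
  'X^N %| (WA * WB - 'X^2 * (ZA * WB + WA * ZB)) * oF
          - 'X * (WA * WB - 'X^2 * (ZA * ZB)).
Proof.
move=> hA kA hB kB hF kF.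
have h1 : 'X^N %| eF - 1.
  apply: (@dvdXn_cancel _ (1 - 'X * (oA - oB))).
    by rewrite hornerD hornerN hornerM hornerX mul0r subr0 hornerC oner_eq0.
  set D := _ - (1 + _) in hF.
  suff -> : (1 - 'X * (oA - oB)) * (eF - 1) =
      D + 'X * ((oB - oF) * (eA - 1) + (oF - oA) * (eB - 1)).
    by rewrite dvdp_add // dvdp_mull // dvdp_add // dvdp_mull.
  by rewrite /D; ring.
split=> //; set D := _ - 'X * _ in kF.
suff -> : (WA * WB - 'X^2 * (ZA * WB + WA * ZB)) * oF
          - 'X * (WA * WB - 'X^2 * (ZA * ZB)) =
    WA * WB * D + 'X * (oF - oB) * WB * (WA * oA - 'X * ZA)
    + ('X * oF * WA - 'X^2 * ZA) * (WB * oB - 'X * ZB)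
    + 'X * WA * WB * (eF - eB) * (eA - 1)
    + 'X * WA * WB * (eB + 1) * (eF - 1).
  by rewrite !dvdp_add // dvdp_mull.
by rewrite /D; ring.
Qed.

Lemma skew_agrees N a d :
  agrees N (a + d).+1 (avsum 0 (2 * a).+2 (2 * d).+1).
Proof.
have [hA kA] := inc_agrees N a; have [hB kB] := inc_agrees N d.
have [h k] := skew_step hA kA hB kB (skew_ev N _ (ltn0Sn _)) (skew_od N _ (ltn0Sn _)).
split=> //; move: k; have [-> /= ->] := den_add a d; rewrite denS.
congr (is_true (_ %| _)); ring.
Qed.

(** For d < k the upper run has length 2 (k - d) = 2 a + 2 with a + d + 1 = k;
    for d = k it is empty. *)
Lemma M_agrees N k d : (d <= k)%N ->
  agrees N k (M_ (pat (2 * k + 1) (2 * d + 1))).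
Proof.
move=> dk.
have E n : M_ (pat (2 * k + 1) (2 * d + 1)) n = avsum 0 (2 * (k - d)) (2 * d).+1 n.
  by rewrite M_avsum; [congr avsum; lia | lia].
have -> : agrees N k (M_ (pat (2 * k + 1) (2 * d + 1)))
        = agrees N k (avsum 0 (2 * (k - d)) (2 * d).+1).
  by rewrite /agrees; do 2!f_equal; rewrite /evpart /odpart;
     under eq_poly => i _ do rewrite E.
case: ltngtP dk => // [dk|->] _; last by rewrite subnn; exact: inc_agrees.
have -> : k = ((k - d).-1 + d).+1 by lia.
rewrite -addSn addnK (_ : 2 * _.+1 = (2 * (k - d).-1).+2)%N; last by lia.
exact: skew_agrees.
Qed.

Lemma agrees_coef k f : (forall N, agrees N k f) ->
  forall n, \sum_(i < n.+1) (den k)`_i * f (n - i)%N = (den k + 'X * num k)`_n.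
Proof.
move=> hf n; have [he ho] := hf n.+1.
have : 'X^(n.+1) %| den k * (\poly_(i < n.+1) f i) - (den k + 'X * num k).
  suff -> : den k * (\poly_(i < n.+1) f i) - (den k + 'X * num k) =
      den k * (evpart n.+1 f - 1) + (den k * odpart n.+1 f - 'X * num k).
    by rewrite dvdp_add // dvdp_mull.
  have -> : \poly_(i < n.+1) f i = evpart n.+1 f + odpart n.+1 f.
    by apply/polyP => i; rewrite coefD !coef_poly; case: ifP; case: odd;
       rewrite ?addr0 ?add0r.
  by ring.
move/dvdXnP/(_ n (ltnSn n)); rewrite coefB => /eqP; rewrite subr_eq0 => /eqP <-.
by rewrite coefM; apply: eq_bigr => i _; rewrite coef_poly ltnS leq_subr.
Qed.

Lemma Rk_comp k : ratfun_comp (Rk k) 'X^2 = (num k)%:F / (den k)%:F.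
Proof.
case: k => [|k].
  rewrite /= -[0 in LHS](mul0r (1%:F)^-1) -{1}tofrac0 ratfun_compE ?oner_eq0 ?size_polyXn //.
  by rewrite comp_poly0 tofrac0 !mul0r.
by rewrite Rk_spec -chebRE ratfun_compE ?chebV_neq0 ?size_polyXn.
Qed.

Theorem theorem2p17 (d k : nat) (hdk : (d <= k)%N) :
  is_expansion (M_ (pat (2 * k + 1) (2 * d + 1)))
               (1 + ratX * ratfun_comp (Rk k) 'X^2).
Proof.
have den0 : den k != 0.
  by apply: contraTneq (oner_neq0 rat) => d0; rewrite -(den_horner0 k) d0 horner0 eqxx.
exists (den k + 'X * num k), (den k); split=> //.
  by rewrite Rk_comp tofracD tofracM mulrDl divff ?tofrac_eq0 // mulrA.
by apply: agrees_coef => N; exact: M_agrees.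
Qed.
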